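(* Let $G$ be a finite connected graph of order $n$ with maximum degree $\Delta$, and let $k$ be a positive integer. Then $$L^{\ell}_{k}(G)\geq \frac{kn}{\Delta(\Delta-k+1)+k},$$ and this bound is sharp.
   Context: Graphs are simple and undirected. The order of $G$ is $|V(G)|$. For a vertex $u$ of $G=(V,E)$, $N[u]=\{u\}\cup\{w\in V : uw\in E\}$ is its closed neighborhood. A subset $B\subseteq V$ is a $k$-limited packing in $G$ if $|N[u]\cap B|\leq k$ for every vertex $u\in V$. The lower $k$-limited packing number $L^{\ell}_{k}(G)$ is the minimum cardinality of a maximal (with respect to inclusion) $k$-limited packing in $G$ (the superscript $\ell$ is part of the notation). ''Sharp'' means that equality is attained.
   Formalization: The formal statement assumes k ≤ Δ+1; without it the inequality fails (for K_2 and k = 3, L = 2 but the bound is 3), and for larger k the denominator can be zero or negative. Sharpness is stated for every pair (Δ, k) with 1 ≤ k ≤ Δ+1. *)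

(* Defs.v *)
From HB Require Import structures.
From mathcomp Require Import all_boot all_order all_algebra.

Set Implicit Arguments.
Unset Strict Implicit.
Unset Printing Implicit Defensive.

Record sgraph := SGraph {
  vertex :> finType;
  adj : rel vertex;
  adj_sym : symmetric adj;
  adj_irrefl : irreflexive adj }.

Definition connected (G : sgraph) : Prop :=
  0 < #|G| /\ forall x y : G, connect (@adj G) x y.

Definition degree (G : sgraph) (v : G) : nat := #|[set w | adj v w]|.

Definition max_degree (G : sgraph) : nat := \max_(v : G) degree v.

Definition closed_nbhd (G : sgraph) (u : G) : {set G} := u |: [set w | adj u w].

Definition limited_packing (G : sgraph) (k : nat) (B : {set G}) : bool :=
  [forall u : G, #|closed_nbhd u :&: B| <= k].

Definition maximal_limited_packing (G : sgraph) (k : nat) (B : {set G}) : bool :=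
  maxset (@limited_packing G k) B.

Lemma maximal_limited_packing_card_ex (G : sgraph) (k : nat) :
  exists m, [exists B : {set G}, maximal_limited_packing k B && (#|B| == m)].
Proof.
have packing0 : @limited_packing G k set0.
  by apply/forallP => u; rewrite setI0 cards0.
have [B maxB _] := maxset_exists packing0.
by exists #|B|; apply/existsP; exists B; rewrite eqxx andbT.
Qed.

Definition lower_limited_packing_number (k : nat) (G : sgraph) : nat :=
  ex_minn (maximal_limited_packing_card_ex G k).

(* Main.v *)
(** The bound is a double count.  Let [B] be a maximal packing and call a vertex
    [u] tight when [N[u]] meets [B] in exactly [k] vertices; by maximality every
    vertex outside [B] has a tight closed neighbour.  Put [m = Delta + 1 - k], let
    [t1] and [t2] count the tight vertices inside and outside [B], and let [r]
    count the edges from the former to the non-tight vertices outside [B].  Then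
    [|V \ B| <= m t2 + r] and [r <= m t1], whereas adding up the degrees over [B]
    gives [(k - 1) t1 + k t2 + r <= Delta |B|].  If [m > 0] then
    [k r = r + (k - 1) r <= m r + (k - 1) m t1], hence
    [k |V \ B| <= m Delta |B|]; if [m = 0] then [B] is all of [V].

    Equality holds for [K_(Delta+1)] if [k = Delta + 1]; otherwise it holds for
    the complete bipartite graph [K_(k,Delta)] with [Delta - k] pendant leaves
    attached to each of the [Delta] vertices of the second side, whose first side
    is a maximal packing. *)
Require Import Defs.
From mathcomp Require Import all_boot all_order all_algebra.
From mathcomp Require Import zify.
Import Order.TTheory GRing.Theory Num.Theory.

Set Implicit Arguments.
Unset Strict Implicit.
Unset Printing Implicit Defensive.
Local Open Scope nat_scope.

(** * Counting in finite sets *)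

Lemma card_bigcup_leq_sum (I T : finType) (P : pred I) (F : I -> {set T}) :
  #|\bigcup_(i | P i) F i| <= \sum_(i | P i) #|F i|.
Proof.
elim/big_rec2: _ => [|i n A _ leAn]; first by rewrite cards0.
by rewrite (leq_trans (leq_card_setU _ _)) // leq_add2l.
Qed.

(** Both sides count the pairs in [A] times [B] related by [e]. This lets edges leaving a packing be
    counted from their other ends. *)
Lemma exchange_sum_cardI (T : finType) (e : rel T) (A B : {set T}) :
  symmetric e ->
  \sum_(x in A) #|[set y | e x y] :&: B| =
  \sum_(y in B) #|[set x | e y x] :&: A|.
Proof.
move=> e_sym.
have cardE (C : {set T}) (x : T) :
    #|[set y | e x y] :&: C| = \sum_(y in C) e x y.
  rewrite -sum1_card big_mkcond [RHS]big_mkcond; apply: eq_bigr => y _.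
  by rewrite !inE; case: (e x y); case: (y \in C).
under eq_bigr do rewrite cardE.
rewrite exchange_big; apply: eq_bigr => y _; rewrite cardE.
by apply: eq_bigr => x _; rewrite e_sym.
Qed.

(** * Maximality of packings in terms of tight vertices *)

Lemma degree_leq_max (G : sgraph) (v : G) : degree v <= max_degree G.
Proof. exact: (leq_bigmax v). Qed.

Lemma card_closed_nbhd (G : sgraph) (u : G) :
  #|closed_nbhd u| = (degree u).+1.
Proof. by rewrite cardsU1 inE adj_irrefl. Qed.

Lemma limited_packingP (G : sgraph) (k : nat) (B : {set G}) :
  reflect (forall u : G, #|closed_nbhd u :&: B| <= k) (limited_packing k B).
Proof. exact: forallP. Qed.

(** Adding [v] must break the packing condition at some [u]. One vertex raises the count at [u] by
    at most one, and only if it lies in [N[u]], so the count was already [k]. *)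
Lemma maximal_packing_tight (G : sgraph) (k : nat) (B : {set G}) (v : G) :
  maximal_limited_packing k B -> v \notin B ->
  exists2 u, v \in closed_nbhd u & #|closed_nbhd u :&: B| = k.
Proof.
case/maxsetP=> /limited_packingP packB maxB vB.
have /forallPn[u] : ~~ limited_packing k (v |: B).
  apply: contra vB => packvB.
  by rewrite -(maxB _ packvB (subsetUr _ _)) setU11.
rewrite -ltnNge setIUr => ltk; have leB := packB u.
have [uv|nuv] := boolP (v \in closed_nbhd u); last first.
  have I0 : closed_nbhd u :&: [set v] = set0.
    apply/setP=> x; rewrite in_setI in_set1 in_set0.
    by have [->|] := eqVneq x v; rewrite ?andbF ?andbT //; apply: negbTE.
  by move: ltk; rewrite I0 set0U ltnNge leB.
exists u => //; apply/eqP; rewrite eqn_leq leB /= -ltnS.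
apply: leq_trans ltk _; apply: leq_trans (leq_card_setU _ _) _.
rewrite -[X in _ <= X]add1n leq_add2r -(cards1 v).
exact/subset_leq_card/subsetIr.
Qed.

(** A strictly larger packing would contain some [v] outside [B], and the tight vertex next to [v]
    would then see more than [k] members. *)
Lemma maximal_packing_of_tight (G : sgraph) (k : nat) (B : {set G}) :
  limited_packing k B ->
  (forall v, v \notin B ->
     exists2 u, v \in closed_nbhd u & #|closed_nbhd u :&: B| = k) ->
  maximal_limited_packing k B.
Proof.
move=> packB tightB; apply/maxsetP; split=> // A /limited_packingP packA sBA.
apply/eqP; rewrite eqEsubset sBA andbT; apply/subsetP=> v vA.
apply: contraT => vB; have [u uv tu] := tightB v vB.
have := packA u; rewrite leqNgt -{1}tu => /negP[].
apply: proper_card; apply/properP; split; first exact: setIS.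
by exists v; rewrite in_setI uv // (negbTE vB).
Qed.

(** * The double count over a maximal packing *)

Lemma maximal_packing_card_bound (G : sgraph) (k : nat) (B : {set G}) :
  0 < k <= (max_degree G).+1 -> maximal_limited_packing k B ->
  k * #|G| <= #|B| * (max_degree G * ((max_degree G).+1 - k) + k).
Proof.
set D := max_degree G; set m := D.+1 - k => /andP[k_gt0 k_leD] maxB.
pose N (u : G) : {set G} := [set w | adj u w].
pose tight (u : G) := #|closed_nbhd u :&: B| == k.
pose T1 := [set u in B | tight u].
pose T2 := [set u in ~: B | tight u].
pose r := \sum_(u in T1) #|N u :\: (B :|: T2)|.
have cardND u : tight u -> #|closed_nbhd u :\: B| <= m.
  move=> /eqP tu; rewrite cardsD tu card_closed_nbhd.
  by rewrite leq_sub2r // ltnS degree_leq_max.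
(* A vertex of [T2] covers itself. Any other [v] outside [B] has a tight closed neighbour [u]: if
   [u] is in [B], then [v] is among the vertices counted by [r]; otherwise [u] is in [T2]. *)
have cover : ~: B \subset (\bigcup_(u in T2) (closed_nbhd u :\: B)) :|:
                          (\bigcup_(u in T1) (N u :\: (B :|: T2))).
  apply/subsetP=> v; rewrite inE => vB.
  have [vT2|vT2] := boolP (v \in T2).
    apply/setUP; left; apply/bigcupP; exists v => //.
    by rewrite in_setD vB setU11.
  have [u uv /eqP tu] := maximal_packing_tight maxB vB.
  apply/setUP; have [uB|uB] := boolP (u \in B).
    right; apply/bigcupP; exists u; first by rewrite inE uB.
    rewrite in_setD in_setU negb_or vB vT2 /=.
    by case/setU1P: uv vB => [->|//]; rewrite uB.
  left; apply/bigcupP; exists u; first by rewrite !inE uB.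
  by rewrite in_setD vB.
have cardCB : #|~: B| <= m * #|T2| + r.
  apply: leq_trans (subset_leq_card cover) _.
  apply: leq_trans (leq_card_setU _ _) _; apply: leq_add; last first.
    exact: card_bigcup_leq_sum.
  apply: leq_trans (card_bigcup_leq_sum _ _) _.
  rewrite mulnC -sum_nat_const; apply: leq_sum => u.
  by rewrite inE => /andP[_]; apply: cardND.
have r_le : r <= m * #|T1|.
  rewrite mulnC -sum_nat_const; apply: leq_sum => u.
  rewrite inE => /andP[_ /cardND]; apply: leq_trans; apply: subset_leq_card.
  by apply: setDSS; [apply: subsetUr|apply: subsetUl].
have degB : k.-1 * #|T1| + k * #|T2| + r <= D * #|B|.
  have sumB : \sum_(b in B) degree b <= D * #|B|.
    rewrite mulnC -sum_nat_const; apply: leq_sum => b _.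
    exact: degree_leq_max.
  apply: leq_trans sumB.
  have degE (b : G) :
      degree b = #|N b :&: B| + #|N b :&: T2| + #|N b :\: (B :|: T2)|.
    rewrite /degree -/(N b) -(cardsID (B :|: T2) (N b)) setIUr cardsU.
    (* The overlap is empty because [T2] avoids [B]. *)
    rewrite [X in _ - X](_ : _ = 0) ?subn0 //.
    apply/eqP; rewrite cards_eq0 -subset0; apply/subsetP=> x.
    by rewrite !inE => /andP[/andP[_ ->]]; rewrite andbF.
  rewrite (eq_bigr _ (fun b _ => degE b)) !big_split /=.
  have sT1B : T1 \subset B by apply/subsetP=> u; rewrite inE => /andP[].
  have sub_sum (F : G -> nat) : \sum_(u in T1) F u <= \sum_(u in B) F u.
    rewrite [X in _ <= X](big_setID T1) /= (setIidPr sT1B).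
    exact: leq_addr.
  apply: leq_add; last exact: sub_sum.
  apply: leq_add.
    (* A tight vertex of [B] is itself one of its [k] members, which leaves [k.-1] neighbours in
       [B]. *)
    apply: leq_trans (sub_sum _); rewrite mulnC -sum_nat_const.
    apply: leq_sum => u; rewrite inE => /andP[uB /eqP <-].
    rewrite setIUl (setIidPl _) ?sub1set //.
    by rewrite cardsU1; case: (_ \notin _) => //=; apply: leq_pred.
  (* Counted from [T2], each vertex contributes a full [k]: it lies outside [B], so all the members
     it sees are proper neighbours. *)
  rewrite exchange_sum_cardI; last exact: adj_sym.
  rewrite mulnC -sum_nat_const; apply: leq_sum => u.
  rewrite !inE => /andP[uB /eqP {1}<-]; apply: subset_leq_card.
  apply/subsetP=> x; rewrite !inE => /andP[/orP[/eqP->|->//] xB].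
  by rewrite xB in uB.
have n_eq : #|G| = #|B| + #|~: B| by rewrite cardsC.
have key : k * #|~: B| <= m * (D * #|B|).
  have [m0|m_gt0] := posnP m.
    have r0 : r = 0 by apply/eqP; rewrite -leqn0; move: r_le; rewrite m0.
    by move: cardCB; rewrite m0 r0 leqn0 => /eqP->; rewrite muln0.
  apply: leq_trans (leq_mul (leqnn m) degB).
  apply: leq_trans (leq_mul (leqnn k) cardCB) _.
  have le1 : k.-1 * r <= k.-1 * (m * #|T1|) by rewrite leq_mul2l r_le orbT.
  have le2 : r <= m * r by rewrite leq_pmull.
  have kE : k * r = k.-1 * r + r by rewrite -{1}(prednK k_gt0) mulSn addnC.
  rewrite !mulnDr kE mulnCA [m * (k.-1 * _)]mulnCA.
  lia.
rewrite n_eq; lia.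
Qed.

(** * From single packings to the packing number *)

Lemma lower_packing_leq (G : sgraph) (k : nat) (B : {set G}) :
  maximal_limited_packing k B -> lower_limited_packing_number k G <= #|B|.
Proof.
move=> maxB; rewrite /lower_limited_packing_number.
case: ex_minnP => m _; apply.
by apply/existsP; exists B; rewrite maxB eqxx.
Qed.

Lemma lower_packing_witness (G : sgraph) (k : nat) :
  exists2 B : {set G}, maximal_limited_packing k B &
    #|B| = lower_limited_packing_number k G.
Proof.
rewrite /lower_limited_packing_number; case: ex_minnP => m.
by case/existsP=> B /andP[maxB /eqP cardB] _; exists B.
Qed.

(** The hypothesis keeps the truncated subtraction exact, so the natural-number bound transfers to
    the rationals. *)
Lemma bound_denominatorE (D k : nat) : k <= D.+1 ->
  (D%:R * (D%:R - k%:R + 1) + k%:R = (D * (D.+1 - k) + k)%:R :> rat)%R.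
Proof. by move=> le_kD; rewrite natrD natrM natrB // -natr1 addrAC. Qed.

Lemma lower_packing_bound (G : sgraph) (k : nat) :
  0 < k <= (max_degree G).+1 ->
  k * #|G| <= lower_limited_packing_number k G *
                (max_degree G * ((max_degree G).+1 - k) + k).
Proof.
move=> k_bounds; have [B maxB <-] := lower_packing_witness G k.
exact: maximal_packing_card_bound.
Qed.

(** One maximal packing meeting the bound suffices: the packing number is squeezed between the bound
    and [#|B|]. *)
Lemma lower_packing_sharp (G : sgraph) (k : nat) (B : {set G}) :
  0 < k <= (max_degree G).+1 -> maximal_limited_packing k B ->
  #|B| * (max_degree G * ((max_degree G).+1 - k) + k) = k * #|G| ->
  lower_limited_packing_number k G *
      (max_degree G * ((max_degree G).+1 - k) + k)
    = k * #|G|.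
Proof.
move=> k_bounds maxB cardB; apply/eqP; rewrite eqn_leq lower_packing_bound //.
by rewrite andbT -cardB leq_mul2r lower_packing_leq ?orbT.
Qed.

(** * Complete graphs, extremal for [k = Delta + 1] *)

Definition complete_rel (n : nat) : rel 'I_n := fun x y => x != y.

Lemma complete_sym (n : nat) : symmetric (@complete_rel n).
Proof. by move=> x y; rewrite /complete_rel eq_sym. Qed.

Lemma complete_irrefl (n : nat) : irreflexive (@complete_rel n).
Proof. by move=> x; rewrite /complete_rel eqxx. Qed.

Definition complete_graph (n : nat) : sgraph :=
  SGraph (@complete_sym n) (@complete_irrefl n).

Lemma complete_connected (n : nat) : 0 < n -> connected (complete_graph n).
Proof.
move=> n_gt0; split; first by rewrite card_ord.
by move=> x y; have [->|xy] := eqVneq x y; [exact: connect0|exact: connect1].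
Qed.

Lemma complete_closed_nbhd (n : nat) (x : complete_graph n) :
  closed_nbhd x = [set: 'I_n].
Proof. by apply/setP=> y; rewrite !inE /= /complete_rel eq_sym orbN. Qed.

Lemma complete_max_degree (n : nat) : max_degree (complete_graph n.+1) = n.
Proof.
have degE (x : complete_graph n.+1) : degree x = n.
  apply/eqP; rewrite -eqSS -card_closed_nbhd complete_closed_nbhd.
  by rewrite cardsT card_ord.
apply/eqP; rewrite eqn_leq -{3}(degE ord0) degree_leq_max andbT.
by apply/bigmax_leqP=> x _; rewrite degE.
Qed.

Lemma complete_maximal_packing (n : nat) :
  maximal_limited_packing n [set: complete_graph n].
Proof.
apply: maximal_packing_of_tight => [|v]; last by rewrite inE.
apply/limited_packingP=> u.
by rewrite setIT complete_closed_nbhd cardsT card_ord.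
Qed.

(** * Bipartite graphs with leaves, extremal for [k <= Delta] *)

(** [inl i] is a vertex of the first side of [K_(a,b)], [inr (j, None)] a vertex
    of the second side, and [inr (j, Some l)] the [l]-th leaf attached to it. *)
Definition leafy_rel (a b c : nat) : rel ('I_a + 'I_b * option 'I_c) :=
  fun x y => match x, y with
  | inl _, inr (_, None) | inr (_, None), inl _ => true
  | inr (j, None), inr (j', Some _) | inr (j, Some _), inr (j', None) => j == j'
  | _, _ => false
  end.

Lemma leafy_sym (a b c : nat) : symmetric (@leafy_rel a b c).
Proof. by move=> [i|[j [l|]]] [i'|[j' [l'|]]] //=; rewrite eq_sym. Qed.

Lemma leafy_irrefl (a b c : nat) : irreflexive (@leafy_rel a b c).
Proof. by move=> [i|[j [l|]]]. Qed.

Definition leafy_graph (a b c : nat) : sgraph :=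
  SGraph (@leafy_sym a b c) (@leafy_irrefl a b c).

Lemma leafy_card (a b c : nat) : #|leafy_graph a b c| = a + b * c.+1.
Proof. by rewrite card_sum card_prod card_option !card_ord. Qed.

Lemma leafy_connected (a b c : nat) :
  0 < a -> 0 < b -> connected (leafy_graph a b c).
Proof.
move=> a_gt0 b_gt0; split; first by rewrite leafy_card addn_gt0 a_gt0.
pose G := leafy_graph a b c; pose x0 : G := inl (Ordinal a_gt0).
have csym : connect_sym (@adj G) by apply: sym_connect_sym; apply: adj_sym.
have hub j : connect (@adj G) x0 (inr (j, None)) by exact: connect1.
suff to_x0 x : connect (@adj G) x0 x.
  by move=> x y; apply: connect_trans (to_x0 y); rewrite csym.
case: x => [i|[j [l|]]] //.
  by apply: connect_trans (hub (Ordinal b_gt0)) _; apply: connect1.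
by apply: connect_trans (hub j) _; apply: connect1; rewrite /= eqxx.
Qed.

(** The degrees are [b] on the first side, [a + c] on the second and 1 at the leaves. *)
Lemma leafy_max_degree (a b c : nat) :
  0 < a -> 0 < b -> a + c <= b -> max_degree (leafy_graph a b c) = b.
Proof.
move=> a_gt0 b_gt0 le_acb; pose G := leafy_graph a b c.
have deg_inl i : @degree G (inl i) = b.
  rewrite -[RHS]card_ord -(card_imset _ (f := fun j => inr (j, None) : G)).
    apply: eq_card => -[i'|[j [l|]]]; rewrite !inE /=; symmetry.
    - by apply/imsetP=> -[].
    - by apply/imsetP=> -[].
    - exact: imset_f.
  by move=> j j' [].
apply/eqP; rewrite eqn_leq -{3}(deg_inl (Ordinal a_gt0)) degree_leq_max andbT.
apply/bigmax_leqP=> -[i|[j [l|]]] _; first by rewrite deg_inl.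
  apply: leq_trans b_gt0; rewrite -(cards1 (inr (j, None) : G)).
  apply: subset_leq_card; apply/subsetP=> -[i'|[j' [l'|]]]; rewrite !inE //=.
  by move=> /eqP->.
apply: leq_trans le_acb.
have -> : a + c = #|[set: 'I_a]| + #|[set: 'I_c]| by rewrite !cardsT !card_ord.
rewrite -(card_imset _ (f := fun i => inl i : G)); last by move=> ? ? [].
rewrite -(card_imset [set: 'I_c] (f := fun l => inr (j, Some l) : G));
  last by move=> ? ? [].
apply: leq_trans (leq_card_setU _ _); apply: subset_leq_card.
apply/subsetP=> x; rewrite inE => xN; apply/setUP.
by case: x xN => [i'|[j' [l'|]]] //= => [_|/eqP<-]; [left|right];
  apply: imset_f.
Qed.

Definition leafy_side (a b c : nat) : {set leafy_graph a b c} :=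
  [set inl i | i : 'I_a].

Lemma card_leafy_side (a b c : nat) : #|leafy_side a b c| = a.
Proof. by rewrite card_imset ?card_ord // => ? ? []. Qed.

(** Each second-side vertex sees the whole first side, hence is tight; it serves as the tight closed
    neighbour of itself and of its leaves. *)
Lemma leafy_side_maximal_packing (a b c : nat) :
  maximal_limited_packing a (leafy_side a b c).
Proof.
apply: maximal_packing_of_tight => [|[i|[j o] _]].
- apply/limited_packingP=> u; rewrite -[X in _ <= X](card_leafy_side a b c).
  exact/subset_leq_card/subsetIr.
- by rewrite imset_f.
exists (inr (j, None)).
  by apply/setU1P; case: o => [l|]; [right; rewrite inE /= | left].
rewrite (setIidPr _) ?card_leafy_side //.
by apply/subsetP=> _ /imsetP[i _ ->]; rewrite !inE.
Qed.

(** * Sharpness and the rational form of the bound *)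

Lemma sharp_graph_exists (D k : nat) : 0 < k <= D.+1 ->
  exists G : sgraph,
    [/\ connected G, max_degree G = D &
      lower_limited_packing_number k G * (D * (D.+1 - k) + k) = k * #|G|].
Proof.
move=> k_bounds; have [k_gt0] := andP k_bounds.
rewrite leq_eqVlt => /predU1P[kD|].
  subst k; exists (complete_graph D.+1); have maxD := complete_max_degree D.
  split=> //; first exact: complete_connected.
  have := @lower_packing_sharp (complete_graph D.+1) D.+1 setT.
  rewrite maxD; apply=> //; first exact: complete_maximal_packing.
  by rewrite subnn muln0 cardsT mulnC.
(* With [D - k] leaves at each second-side vertex, the order is [k + D * (D - k + 1)], the
   denominator of the bound, so a packing of size [k] attains it. *)
rewrite ltnS => le_kD; pose G := leafy_graph k D (D - k).
have D_gt0 := leq_trans k_gt0 le_kD.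
have maxD : max_degree G = D by apply: leafy_max_degree; rewrite ?subnKC.
exists G; split=> //; first exact: leafy_connected.
have := @lower_packing_sharp G k (leafy_side k D (D - k)).
rewrite maxD; apply=> //; first exact: leafy_side_maximal_packing.
by rewrite card_leafy_side leafy_card subSn // addnC.
Qed.

Local Open Scope ring_scope.

Theorem theorem2p2 :
  (forall (G : sgraph) (n Delta k : nat),
     connected G -> #|G| = n -> max_degree G = Delta ->
     (0 < k)%N -> (k <= Delta.+1)%N ->
     k%:R * n%:R / (Delta%:R * (Delta%:R - k%:R + 1) + k%:R)
       <= (lower_limited_packing_number k G)%:R :> rat)
  /\
  (forall Delta k : nat,
     (0 < k)%N -> (k <= Delta.+1)%N ->
     exists G : sgraph,
       [/\ connected G, max_degree G = Delta &
         (lower_limited_packing_number k G)%:R =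
         k%:R * #|G|%:R / (Delta%:R * (Delta%:R - k%:R + 1) + k%:R) :> rat]).
Proof.
split=> [G n D k _ <- <- k_gt0 le_kD|D k k_gt0 le_kD];
  have den_gt0 m : (0 < m + k)%N by rewrite addn_gt0 k_gt0 orbT.
  rewrite bound_denominatorE // ler_pdivrMr ?ltr0n // -!natrM ler_nat.
  by rewrite lower_packing_bound ?k_gt0.
have [|G [connG maxG eqG]] := @sharp_graph_exists D k; first by rewrite k_gt0.
exists G; split=> //; rewrite bound_denominatorE // -natrM -eqG natrM mulfK //.
by rewrite pnatr_eq0 -lt0n.
Qed.
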